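(* For any $\eta>0$ and any $\lambda\in(0.8\gamma^{-1},\gamma^{-1})$, the primal-dual smoothing framework (Algorithm 1, described in the context) terminates in at most $$\left\lceil\frac{q(x_1)-q^*}{\left(\frac{\gamma\lambda}{1-\gamma\lambda}-4\right)\eta}\right\rceil+1$$ iterations, where $q^*>-\infty$ is the optimal value of $\min_{x\in\mathbb X}q(x)$.
   Context: Problem. $\mathbb X,\mathbb Y$ are finite-dimensional real normed spaces (norms $\|\cdot\|$, dual norms $\|\cdot\|_*$). $r:\mathbb X\to\mathbb R\cup\{+\infty\}$ is closed and convex with $\mathcal X:=\operatorname{dom} r$ nonempty, closed, convex. $\mathcal Y\subseteq\mathbb Y$ is nonempty, convex and compact; $g:\mathcal Y\to\mathbb R$ is convex and continuous. $\mathcal X'\supseteq\mathcal X$, $\mathcal Y'\supseteq\mathcal Y$ are open; $\Phi:\mathcal X'\times\mathcal Y'\to\mathbb R$ is jointly continuous and $\Phi(x,\cdot)$ is concave on $\mathcal Y$ for each $x\in\mathcal X$. Let $f(x):=\max_{y\in\mathcal Y}\Phi(x,y)-g(y)$, $q:=f+r$ (equal to $+\infty$ off $\mathcal X$), $q^*:=\min_{x\in\mathbb X}q(x)$, assumed $>-\infty$. Assumptions: (1) for $y\in\mathcal Y$, $\Phi(\cdot,y)$ is differentiable on $\mathcal X'$ and for $x,x'\in\mathcal X$, $y,y'\in\mathcal Y$: $\|\nabla_x\Phi(x,y)-\nabla_x\Phi(x',y)\|_*\le L_{xx}\|x-x'\|$, $\|\nabla_x\Phi(x,y)-\nabla_x\Phi(x,y')\|_*\le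 L_{xy}\|y-y'\|$. (2) For some $\gamma\in(0,L_{xx}]$, for all $y\in\mathcal Y$, $x,x'\in\mathcal X$: $\Phi(x',y)-\Phi(x,y)-\langle\nabla_x\Phi(x,y),x'-x\rangle\ge-(\gamma/2)\|x'-x\|^2$. (3) For $x\in\mathcal X$, $\Phi(x,\cdot)$ is differentiable on $\mathcal Y'$ and for $x,x'\in\mathcal X$, $y,y'\in\mathcal Y$: $\|\nabla_y\Phi(x,y)-\nabla_y\Phi(x',y)\|_*\le L_{xy}\|x-x'\|$, $\|\nabla_y\Phi(x,y)-\nabla_y\Phi(x,y')\|_*\le L_{yy}\|y-y'\|$. Distance generating functions (DGF). For a nonempty closed convex set $\mathcal U$ in a finite-dimensional normed space $\mathbb U$, $\omega_{\mathcal U}:\mathbb U\to\mathbb R\cup\{+\infty\}$ is a DGF on $\mathcal U$ if it is continuous and 1-strongly convex on $\mathcal U$ and essentially smooth (continuously differentiable on $\operatorname{int}\operatorname{dom}\omega_{\mathcal U}$, with $\|\nabla\omega_{\mathcal U}(u_k)\|_*\to+\infty$ whenever $u_k\in\operatorname{int}\operatorname{dom}\omega_{\mathcal U}$ converges to a boundary point of $\operatorname{dom}\omega_{\mathcal U}$). $D_{\omega_{\mathcal U}}(u',u):=\omega_{\mathcal U}(u')-\omega_{\mathcal U}(u)-\langle\nabla\omega_{\mathcal U}(u),u'-u\rangle$. $\omega_{\mathcal X}$ is a DGF on $\mathcal X$ that is twice continuously differentiable on $\operatorname{int}\operatorname{dom}\omega_{\mathcal X}$, with $\mathcal X\subseteq\operatorname{int}\operatorname{dom}\omega_{\mathcal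 X}$ and $\nabla\omega_{\mathcal X}$ $\beta_{\mathcal X}$-Lipschitz on $\mathcal X$, $\beta_{\mathcal X}\in[1,\infty)$. $\omega_{\mathcal Y}$ is a DGF on $\mathcal Y$, and $R_{\mathcal Y}(\omega_{\mathcal Y}):=\sup_{y\in\mathcal Y}|\omega_{\mathcal Y}(y)|<\infty$ (positive, as implicit in the choice of $\rho$ below). Smoothing. For $\rho>0$: $f_\rho(x):=\max_{y\in\mathcal Y}\Phi(x,y)-g(y)-\rho\,\omega_{\mathcal Y}(y)$ and $q_\rho:=f_\rho+r$. For $0<\lambda<\gamma^{-1}$, $x\in\mathcal X$: $Q_\rho^\lambda(x';x):=q_\rho(x')+\lambda^{-1}D_{\omega_{\mathcal X}}(x',x)$, $q_\rho^\lambda(x):=\min_{x'\in\mathbb X}Q_\rho^\lambda(x';x)$. Algorithm 1. Input: $\eta>0$, $\lambda\in(0,\gamma^{-1})$, $\rho:=2\eta/R_{\mathcal Y}(\omega_{\mathcal Y})$, $x_1\in\mathcal X$. For $k=1,2,\ldots$: find any $x_{k+1}\in\mathcal X$ with $Q_\rho^\lambda(x_{k+1};x_k)\le q_\rho^\lambda(x_k)+\eta$; terminate at the first $k$ for which $\|x_{k+1}-x_k\|\le\sqrt{2\eta/(\lambda^{-1}-\gamma)}$; this $k$ is denoted $K$ (the number of iterations) and the output is $x_K$. *)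

(* Defs.v *)
From HB Require Import structures.
From mathcomp Require Import all_boot all_order all_algebra.
From mathcomp Require Import all_classical all_reals all_analysis.

Set Implicit Arguments.
Unset Strict Implicit.
Unset Printing Implicit Defensive.

Import Order.TTheory GRing.Theory Num.Theory.
Import numFieldNormedType.Exports.

Local Open Scope classical_set_scope.
Local Open Scope ring_scope.

(* Functions valued in R U {+oo} are functions to \bar R that never take the
   value -oo.  Maxima and minima of the source are written as suprema and
   infima in \bar R, without presupposing that they are attained. *)

Section convex_analysis.
Context {R : realType} {U : normedModType R}.
Implicit Types (w : U -> \bar R) (f : U -> R) (A : set U).

Definition finite_dimensional (V : normedModType R) : Prop :=
  exists (n : nat) (e : 'I_n -> V),
    forall v : V, exists c : 'I_n -> R, v = \sum_(i < n) c i *: e i.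

Definition dual_norm (l : U -> R) : \bar R :=
  ereal_sup [set (`|l v|)%:E | v in [set v : U | `|v| <= 1]].

Definition edom w : set U := [set u | (w u < +oo)%E].

Definition epigraph w : set (U * R^o)%type := [set p | (w p.1 <= p.2%:E)%E].

Definition closed_convex_fun w : Prop :=
  closed (epigraph w) /\ convex_set (epigraph w).

Definition strongly_convex1_on A w : Prop :=
  forall (u v : U) (t : R), A u -> A v -> 0 <= t <= 1 ->
    (w (t *: u + (1 - t) *: v)%R
       + (2^-1 * (t * (1 - t)) * `|u - v| ^+ 2)%R%:E
     <= t%:E * w u + (1 - t)%R%:E * w v)%E.

(* The gradient u |-> 'd f u takes values in the dual of U, so that its
   continuity is with respect to the dual norm. *)
Definition C1_on A f : Prop :=
  forall u, A u -> differentiable f u /\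
    dual_norm (fun v => 'd f z v - 'd f u v) @[z --> u] --> 0%E.

(* U is meant to be finite-dimensional: the gradient is then C^1 as soon as
   each of its evaluations u |-> 'd f u v is. *)
Definition C2_on A f : Prop :=
  C1_on A f /\ forall v : U, C1_on A (fun u => 'd f u v).

(* [fine \o w] is the real-valued function that coincides with [w] on
   [edom w]; it is only differentiated in the interior of [edom w]. *)
Definition grad w (u : U) : U -> R := 'd (fine \o w) u.

Definition essentially_smooth w : Prop :=
  C1_on (edom w)° (fine \o w) /\
  forall (u : nat -> U) (u0 : U),
    (forall k, (edom w)° (u k)) -> u @ \oo --> u0 ->
    (closure (edom w) `\` (edom w)°) u0 ->
    dual_norm (grad w (u k)) @[k --> \oo] --> +oo%E.

Definition dgf A w : Prop :=
  [/\ forall u, w u != -oo%E,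
      {within A, continuous w},
      strongly_convex1_on A w &
      essentially_smooth w].

Definition bregman w (u' u : U) : \bar R :=
  (w u' - w u - (grad w u (u' - u)%R)%:E)%E.

Definition dgf_sup A w : \bar R := ereal_sup [set `|w u|%E | u in A].

End convex_analysis.

Section primal_dual_smoothing.
Context {R : realType} {X Y : normedModType R}.
Variables (Phi : X -> Y -> R) (g : Y -> R) (r : X -> \bar R) (Yc : set Y).
Variables (omegaX : X -> \bar R) (omegaY : Y -> \bar R).

Definition gradx (x : X) (y : Y) : X -> R := 'd (fun z => Phi z y) x.
Definition grady (x : X) (y : Y) : Y -> R := 'd (Phi x) y.

Definition maxf (x : X) : \bar R :=
  ereal_sup [set (Phi x y - g y)%:E | y in Yc].

Definition q (x : X) : \bar R := (maxf x + r x)%E.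

Definition qstar : \bar R := ereal_inf (range q).

Definition maxf_smooth (rho : R) (x : X) : \bar R :=
  ereal_sup [set ((Phi x y - g y)%R%:E - rho%:E * omegaY y)%E | y in Yc].

Definition q_smooth (rho : R) (x : X) : \bar R := (maxf_smooth rho x + r x)%E.

Definition Q_smooth (rho lambda : R) (x' x : X) : \bar R :=
  (q_smooth rho x' + (lambda^-1)%:E * bregman omegaX x' x)%E.

Definition q_envelope (rho lambda : R) (x : X) : \bar R :=
  ereal_inf (range (fun x' => Q_smooth rho lambda x' x)).

Definition pds_rho (eta : R) : R := 2 * eta / fine (dgf_sup Yc omegaY).

Definition pds_stop (gamma eta lambda : R) (x : nat -> X) (k : nat) : bool :=
  `|x k.+1 - x k| <= Num.sqrt (2 * eta / (lambda^-1 - gamma)).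

(* Iterates are numbered from 1 ([x 0] is irrelevant), and nothing is required
   of the terms of the sequence [x] that come after termination. *)
Definition pds_run (gamma eta lambda : R) (x : nat -> X) : Prop :=
  edom r (x 1%N) /\
  forall k, (1 <= k)%N ->
    (forall j, (1 <= j < k)%N -> ~~ pds_stop gamma eta lambda x j) ->
    edom r (x k.+1) /\
    (Q_smooth (pds_rho eta) lambda (x k.+1) (x k)
       <= q_envelope (pds_rho eta) lambda (x k) + eta%:E)%E.

Definition pds_iterations (gamma eta lambda : R) (x : nat -> X) (K : nat)
    : Prop :=
  [/\ (1 <= K)%N, pds_stop gamma eta lambda x K &
      forall j, (1 <= j < K)%N -> ~~ pds_stop gamma eta lambda x j].

End primal_dual_smoothing.

(* Main.v *)
Require Import Defs.
From HB Require Import structures.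
From mathcomp Require Import all_boot all_order all_algebra.
From mathcomp Require Import all_classical all_reals all_analysis.
From mathcomp Require Import ring lra.

Set Implicit Arguments.
Unset Strict Implicit.
Unset Printing Implicit Defensive.

Import Order.TTheory GRing.Theory Num.Theory.
Import numFieldNormedType.Exports.

Local Open Scope classical_set_scope.
Local Open Scope ring_scope.

(** Every inexact proximal step that does not trigger the stopping test
    decreases the smoothed objective [q_smooth] by a fixed amount, and
    [q_smooth] stays within [2 * eta] of [q], which is bounded below.

    For the decrease, compare [x k.+1] with the competitor [x k] itself in the
    subproblem: the Bregman term of the competitor vanishes, while that of
    [x k.+1] is at least [`|x k.+1 - x k| ^+ 2 / 2] by strong convexity
    ([bregman_ge]).  Hence the step gains [`|x k.+1 - x k| ^+ 2 / (2 * lambda)]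
    up to the error [eta] ([inexact_prox_descent]).  A step longer than the
    stopping threshold therefore gains at least [c * eta], where
    [c = gamma * lambda / (1 - gamma * lambda)] ([step_decrease]).

    The choice [rho = 2 * eta / sup |omegaY|] makes [rho * omegaY] bounded by
    [2 * eta] on [Yc], hence [`|q_smooth - q| <= 2 * eta] on the domain of [r]
    ([maxf_smooth_bounds]).  Telescoping over the [K - 1] steps that precede
    the last one gives [(K - 1) * c * eta <= q (x 1) - qstar + 4 * eta]
    ([first_stop]).  When [K >= 2], the smoothing error [4 * eta] is at most
    [(K - 1) * 4 * eta] and is absorbed into the constant: this turns [c] into
    [c - 4], positive exactly because [4 / 5 < gamma * lambda].  When [K = 1]
    the bound holds because its ceiling term is nonnegative. *)

(** * Strong convexity and the Bregman distance *)

(** On the segment from [u] to [u'], strong convexity bounds the slope of [w]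
    at [u] by [w u' - w u - (1 - h) / 2 * `|u' - u| ^+ 2], where [h] is the
    fraction of the segment; as [h] tends to [0] the slope tends to the
    gradient term of the Bregman distance. *)
Lemma bregman_ge (R : realType) (U : normedModType R) (A : set U)
    (w : U -> \bar R) (u u' : U) :
  (forall z, w z != -oo%E) -> strongly_convex1_on A w ->
  A u -> A u' -> edom w u -> edom w u' -> differentiable (fine \o w) u ->
  ((2^-1 * `|u' - u| ^+ 2)%:E <= bregman w u' u)%E.
Proof.
move=> wNy wsc Au Au' wu wu' wdiff; rewrite /bregman /grad.
have wfin z : edom w z -> w z = (fine (w z))%:E.
  by move=> wz; rewrite fineK// fin_numE wNy -ltey.
set v := u' - u; rewrite (wfin _ wu) (wfin _ wu') -!EFinB lee_fin.
set a := fine (w u); set b := fine (w u'); set N := `|v| ^+ 2.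
pose slope h : R := h^-1 *: ((fine \o w \o shift u) (h *: v) - (fine \o w) u).
have slope_cvg : slope h @[h --> 0^'+] --> 'd (fine \o w) u v.
  rewrite -(deriveE v wdiff).
  by apply: cvg_dnbhs_at_right; exact: (diff_derivable wdiff).
pose chord (h : R) : R := b - a - 2^-1 * (1 - h) * N.
have chord_cvg : chord h @[h --> 0^'+] --> b - a - 2^-1 * N.
  have -> : b - a - 2^-1 * N = chord 0 by rewrite /chord subr0 mulr1.
  apply: cvg_at_right_filter; apply: cvgB; first exact: cvg_cst.
  apply: cvgMl; apply: cvgMr; apply: cvgB; first exact: cvg_cst.
  exact: cvg_id.
(* [wsc] controls [w] only inside the segment, hence the one-sided limit. *)
suff : 'd (fine \o w) u v <= b - a - 2^-1 * N by rewrite lerBrDl -lerBrDr.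
apply: (ler_cvg_to slope_cvg chord_cvg); near=> h.
have h0 : 0 < h by near: h; exact: nbhs_right_gt.
have h1 : h <= 1 by near: h; exact: nbhs_right_le.
have h01 : 0 <= h <= 1 by rewrite ltW.
have segE : h *: u' + (1 - h) *: u = h *: v + u.
  by rewrite /v scalerBl scale1r scalerBr addrCA [RHS]addrC addrA addrC.
have := wsc u' u h Au' Au h01; rewrite segE.
rewrite (wfin _ wu) (wfin _ wu') -!EFinM -EFinD -/a -/b -/v -/N.
have wNy' := wNy (h *: v + u).
rewrite /slope /= /shift /= -/a.
case: (w (h *: v + u)) wNy' => [c _| |//]; last by rewrite addye// leye_eq.
rewrite -EFinD lee_fin => chord_le /=.
rewrite -[_ *: _]/(_ * _) ler_pdivrMl// /chord.
by nra.
Unshelve. all: by end_near. Qed.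

Lemma bregmanxx (R : realType) (U : normedModType R) (w : U -> \bar R) u :
  w u \is a fin_num -> bregman w u u = 0%E.
Proof. by move=> wu; rewrite /bregman /grad subrr linear0 sube0 subee. Qed.

(** * The smoothed maximum *)

Lemma max_fin_num (R : realType) (T : topologicalType) (A : set T)
    (f : T -> R) :
  A !=set0 -> compact A -> {within A, continuous f} ->
  ereal_sup [set (f y)%:E | y in A] \is a fin_num.
Proof.
move=> A0 Ac fc; have [c cA fmax] := compact_EVT_max A0 Ac fc.
suff -> : ereal_sup [set (f y)%:E | y in A] = (f c)%:E by [].
apply/eqP; rewrite eq_le; apply/andP; split.
  by apply: ge_ereal_sup => _ [y Ay <-]; rewrite lee_fin fmax// inE.
by apply: ereal_sup_ubound; exists c => //; rewrite -inE.
Qed.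

(** [rho] is scaled so that [`|rho * omegaY| <= 2 * eta] on [Yc]; a pointwise
    perturbation of that size moves a supremum by no more. *)
Lemma maxf_smooth_bounds (R : realType) (X Y : normedModType R)
    (Phi : X -> Y -> R) (g : Y -> R) (Yc : set Y) (omegaY : Y -> \bar R)
    (eta : R) (x : X) :
  0 <= eta -> (0 < dgf_sup Yc omegaY < +oo)%E ->
  (maxf Phi g Yc x - (2 * eta)%:E
     <= maxf_smooth Phi g Yc omegaY (pds_rho Yc omegaY eta) x
     <= maxf Phi g Yc x + (2 * eta)%:E)%E.
Proof.
move=> eta0 /andP[sup_gt0 sup_lty]; rewrite /maxf /maxf_smooth /pds_rho.
have supE : dgf_sup Yc omegaY = (fine (dgf_sup Yc omegaY))%:E.
  by rewrite fineK// ge0_fin_numE// ltW.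
set D := fine _ in supE *; rewrite supE lte_fin in sup_gt0.
(* The bound on [omegaY] also makes it finite on [Yc], so that subtracting
   [rho * omegaY] is a real subtraction. *)
have rho_omega y : Yc y -> exists2 p : R,
    ((2 * eta / D)%:E * omegaY y)%E = p%:E & `|p| <= 2 * eta.
  move=> Yy; have : (`|omegaY y| <= D%:E)%E.
    by rewrite -supE; apply: ereal_sup_ubound; exists y.
  case: (omegaY y) => [p| |] //=; rewrite lee_fin => pD.
  exists (2 * eta / D * p) => //.
  rewrite normrM (ger0_norm (_ : 0 <= 2 * eta / D)); last first.
    by rewrite divr_ge0 ?mulr_ge0// ltW.
  by rewrite mulrAC ler_pdivrMr// ler_wpM2l ?mulr_ge0.
apply/andP; split.
  rewrite leeBlDr//; apply: ge_ereal_sup => _ [y Yy <-].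
  have [p pE p_le] := rho_omega y Yy.
  rewrite -leeBlDr//; apply: ereal_sup_ge.
  exists ((Phi x y - g y)%:E - (2 * eta / D)%:E * omegaY y)%E.
    by exists y.
  by rewrite pE -!EFinB lee_fin lerB// (le_trans (ler_norm p)).
apply: ge_ereal_sup => _ [y Yy <-]; have [p -> p_le] := rho_omega y Yy.
rewrite -leeBlDr//; apply: ereal_sup_ge.
exists ((Phi x y - g y)%:E)%E; first by exists y.
rewrite -!EFinB lee_fin; have := ler_norm (- p); rewrite normrN; lra.
Qed.

(** * Decrease along the iterations *)

(** Staying at [z] is admissible in the proximal subproblem and costs
    [qs z], so a near-minimizer [z'] pays for its Bregman term by lowering
    [qs]. *)
Lemma inexact_prox_descent (R : realType) (X Y : normedModType R)
    (Phi : X -> Y -> R) (g : Y -> R) (r : X -> \bar R) (Yc : set Y)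
    (omegaX : X -> \bar R) (omegaY : Y -> \bar R) (rho lambda eta : R)
    (z z' : X) :
  let qs := q_smooth Phi g r Yc omegaY rho in
  0 < lambda -> omegaX z \is a fin_num ->
  qs z \is a fin_num -> qs z' \is a fin_num ->
  ((2^-1 * `|z' - z| ^+ 2)%:E <= bregman omegaX z' z)%E ->
  (Q_smooth Phi g r Yc omegaX omegaY rho lambda z' z
     <= q_envelope Phi g r Yc omegaX omegaY rho lambda z + eta%:E)%E ->
  fine (qs z') + lambda^-1 * (2^-1 * `|z' - z| ^+ 2) <= fine (qs z) + eta.
Proof.
move=> qs lambda0 wz qsz qsz' breg near_opt; rewrite -lee_fin !EFinD !fineK//.
have Qz : Q_smooth Phi g r Yc omegaX omegaY rho lambda z z = qs z.
  by rewrite /Q_smooth bregmanxx// mule0 adde0.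
have env_le : (q_envelope Phi g r Yc omegaX omegaY rho lambda z <= qs z)%E.
  by rewrite -Qz; apply: ereal_inf_lbound; exists z.
apply: le_trans (le_trans near_opt (leeD2r _ env_le)).
by rewrite leeD2l// EFinM lee_wpmul2l// lee_fin invr_ge0 ltW.
Qed.

(** Half the squared stopping threshold, divided by [lambda], equals
    [eta / (1 - gamma * lambda)], which is the left-hand side. *)
Lemma step_decrease (R : realFieldType) (gamma lambda eta d : R) :
  0 < lambda -> lambda < gamma^-1 -> 0 < gamma ->
  2 * eta / (lambda^-1 - gamma) <= d ->
  gamma * lambda / (1 - gamma * lambda) * eta + eta <= lambda^-1 * (2^-1 * d).
Proof.
move=> l0 lg g0 dge.
have gl1 : 0 < 1 - gamma * lambda.
  by rewrite subr_gt0 mulrC -ltr_pdivlMr// div1r.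
apply: (@le_trans _ _ (lambda^-1 * (2^-1 * (2 * eta / (lambda^-1 - gamma))))).
  rewrite le_eqVlt; apply/orP; left; apply/eqP; field.
  by rewrite mulNr !gt_eqF.
by rewrite ler_pM2l ?invr_gt0// ler_pM2l// invr_gt0.
Qed.

(** A quantity bounded below cannot decrease by [a] for ever.  Both hypotheses
    are restricted to indices not yet preceded by a stop, because nothing is
    known about an algorithm after its termination. *)
Lemma first_stop (R : archiRealFieldType) (stop : pred nat) (F : nat -> R)
    (a m : R) : 0 < a ->
  (forall k, (1 <= k)%N -> (forall j, (1 <= j <= k)%N -> ~~ stop j) ->
     F k.+1 + a <= F k) ->
  (forall k, (1 <= k)%N -> (forall j, (1 <= j < k)%N -> ~~ stop j) ->
     m <= F k) ->
  exists K : nat,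
    [/\ (1 <= K)%N, stop K & forall j, (1 <= j < K)%N -> ~~ stop j] /\
    K.-1%:R * a <= F 1%N - m.
Proof.
move=> a0 descent lower.
have bound k : (1 <= k)%N -> (forall j, (1 <= j < k)%N -> ~~ stop j) ->
    k.-1%:R * a <= F 1%N - m.
  move=> k1 nstop; have mFk := lower k k1 nstop.
  suff : F k + k.-1%:R * a <= F 1%N by move=> ?; lra.
  elim: k k1 nstop {mFk} => [//|[_ _ _|k IH _ nstop]].
    by rewrite mul0r addr0.
  have IHk : F k.+1 + k%:R * a <= F 1%N.
    by apply: IH => // j /andP[j1 jk]; apply: nstop; rewrite j1 (ltn_trans jk).
  by have := descent k.+1 isT nstop; rewrite -natr1 mulrDl; lra.
(* Without a stop, [bound] at an index beyond [(F 1 - m) / a] is absurd. *)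
have [K /andP[K1 stopK] Kmin] : exists2 K, (1 <= K)%N && stop K &
    forall j, (1 <= j)%N && stop j -> (K <= j)%N.
  suff ex : exists K, (1 <= K)%N && stop K.
    by case: (ex_minnP ex) => K; exists K.
  apply: contrapT => never.
  have nstop j : (1 <= j)%N -> ~~ stop j.
    by move=> j1; apply/negP => sj; apply: never; exists j; rewrite j1.
  pose n := Num.bound `|(F 1%N - m) / a|.
  have := bound n.+1 isT (fun j jn => nstop j (proj1 (andP jn))).
  by rewrite -ler_pdivlMr//= leNgt (le_lt_trans (ler_norm _)) ?archi_boundP.
have nstop j : (1 <= j < K)%N -> ~~ stop j.
  case/andP=> j1 jK; apply/negP => sj.
  by have := Kmin j; rewrite j1 sj leqNgt jK => /(_ isT).
by exists K; split=> //; exact: bound.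
Qed.

(** * The iteration bound *)

Theorem theorem4p2 (R : realType) (X Y : normedModType R)
    (finX : finite_dimensional X) (finY : finite_dimensional Y)
    (r : X -> \bar R) (Yc : set Y) (g : Y -> R)
    (X' : set X) (Y' : set Y) (Phi : X -> Y -> R)
    (Lxx Lxy Lyy gamma betaX : R)
    (omegaX : X -> \bar R) (omegaY : Y -> \bar R)
    (r_proper : forall x, r x != -oo%E)
    (r_closed_convex : closed_convex_fun r)
    (domr_nonempty : edom r !=set0)
    (domr_closed : closed (edom r))
    (domr_convex : convex_set (edom r))
    (Yc_nonempty : Yc !=set0) (Yc_convex : convex_set Yc)
    (Yc_compact : compact Yc)
    (g_convex : convex_function Yc g)
    (g_continuous : {within Yc, continuous g})
    (X'_open : open X') (X'_sup : edom r `<=` X')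
    (Y'_open : open Y') (Y'_sup : Yc `<=` Y')
    (Phi_continuous :
      {in X' `*` Y', continuous (fun p : X * Y => Phi p.1 p.2)})
    (Phi_concave : forall x, edom r x ->
      convex_function Yc (fun y => - Phi x y))
    (qstar_gt : (-oo < qstar Phi g r Yc)%E)
    (* smoothness in x *)
    (Phi_diffx : forall x y, X' x -> Yc y ->
      differentiable (fun z => Phi z y) x)
    (gradx_lip_x : forall x x' y, edom r x -> edom r x' -> Yc y ->
      (dual_norm (fun v => gradx Phi x y v - gradx Phi x' y v)%R
         <= (Lxx * `|x - x'|)%:E)%E)
    (gradx_lip_y : forall x y y', edom r x -> Yc y -> Yc y' ->
      (dual_norm (fun v => gradx Phi x y v - gradx Phi x y' v)%R
         <= (Lxy * `|y - y'|)%:E)%E)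
    (* weak convexity in x *)
    (gamma_gt0 : 0 < gamma) (gamma_le : gamma <= Lxx)
    (Phi_weakly_convex : forall x x' y, edom r x -> edom r x' -> Yc y ->
      Phi x' y - Phi x y - gradx Phi x y (x' - x)
        >= - (gamma / 2 * `|x' - x| ^+ 2))
    (* smoothness in y *)
    (Phi_diffy : forall x y, edom r x -> Y' y -> differentiable (Phi x) y)
    (grady_lip_x : forall x x' y, edom r x -> edom r x' -> Yc y ->
      (dual_norm (fun v => grady Phi x y v - grady Phi x' y v)%R
         <= (Lxy * `|x - x'|)%:E)%E)
    (grady_lip_y : forall x y y', edom r x -> Yc y -> Yc y' ->
      (dual_norm (fun v => grady Phi x y v - grady Phi x y' v)%R
         <= (Lyy * `|y - y'|)%:E)%E)
    (* distance generating functions *)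
    (omegaX_dgf : dgf (edom r) omegaX)
    (omegaX_C2 : C2_on (edom omegaX)° (fine \o omegaX))
    (omegaX_dom : edom r `<=` (edom omegaX)°)
    (betaX_ge1 : 1 <= betaX)
    (omegaX_lip : forall x x', edom r x -> edom r x' ->
      (dual_norm (fun v => grad omegaX x v - grad omegaX x' v)%R
         <= (betaX * `|x - x'|)%:E)%E)
    (omegaY_dgf : dgf Yc omegaY)
    (omegaY_sup_gt0 : (0 < dgf_sup Yc omegaY)%E)
    (omegaY_sup_fin : (dgf_sup Yc omegaY < +oo)%E)
    (eta lambda : R) (eta_gt0 : 0 < eta)
    (lambda_gt : 4 / 5 * gamma^-1 < lambda) (lambda_lt : lambda < gamma^-1)
    (x : nat -> X)
    (x_run : pds_run Phi g r Yc omegaX omegaY gamma eta lambda x) :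
  exists K : nat,
    pds_iterations gamma eta lambda x K /\
    K%:Z <= Num.ceil ((fine (q Phi g r Yc (x 1%N)) - fine (qstar Phi g r Yc))
                / ((gamma * lambda / (1 - gamma * lambda) - 4) * eta)) + 1.
Proof.
have gammaV : 0 < gamma^-1 by rewrite invr_gt0.
have lambda0 : 0 < lambda by apply: lt_trans lambda_gt; rewrite mulr_gt0.
have gl1 : 0 < 1 - gamma * lambda.
  by rewrite subr_gt0 mulrC -ltr_pdivlMr// div1r.
have gl45 : 4 / 5 < gamma * lambda by rewrite -ltr_pdivrMl// mulrC.
have [omegaX_Ny _ omegaX_sc [omegaX_C1 _]] := omegaX_dgf.
have omegaX_edom z : edom r z -> edom omegaX z.
  by move=> /omegaX_dom; exact: interior_subset.
set rho := pds_rho Yc omegaY eta.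
pose qs := q_smooth Phi g r Yc omegaY rho.
pose qv := q Phi g r Yc.
have sup_bnd : (0 < dgf_sup Yc omegaY < +oo)%E by rewrite omegaY_sup_gt0.
(* [q] and [qs] must be real on the domain of [r] before [fine] can be used:
   [fine +oo = 0]. *)
have max_fin z : edom r z -> maxf Phi g Yc z \is a fin_num.
  move=> rz; apply: max_fin_num => // y; apply: continuousB.
    apply: continuous_in_subspaceT => {}y /set_mem Yy.
    by apply: differentiable_continuous; apply: Phi_diffy => //; exact: Y'_sup.
  exact: g_continuous.
have r_fin z : edom r z -> r z \is a fin_num.
  by move=> rz; rewrite fin_numE r_proper -ltey.
have qv_fin z : edom r z -> qv z \is a fin_num.
  by move=> rz; rewrite fin_numD max_fin// r_fin.
have qs_bnd z : edom r z -> qs z \is a fin_num /\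
    fine (qv z) - 2 * eta <= fine (qs z) <= fine (qv z) + 2 * eta.
  move=> rz; have := maxf_smooth_bounds Phi g z (ltW eta_gt0) sup_bnd.
  rewrite /qs /qv /q_smooth /q -/rho.
  move: (max_fin z rz) (r_fin z rz).
  case: (maxf Phi g Yc z) => [m| |] // _; case: (r z) => [p| |] // _.
  case: (maxf_smooth _ _ _ _ _ _) => [n| |];
    rewrite -?EFinB -?EFinD ?leye_eq ?leeNy_eq ?andbF //.
  rewrite /= !lee_fin => /andP[? ?]; split=> //; lra.
have qstar_le z : (qstar Phi g r Yc <= qv z)%E.
  by apply: ereal_inf_lbound; exists z.
have [x1 x_next] := x_run.
have qstar_fin : qstar Phi g r Yc \is a fin_num.
  rewrite fin_numE -!ltNye qstar_gt -ltey (le_lt_trans (qstar_le (x 1%N)))//.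
  by rewrite ltey_eq qv_fin.
set c := gamma * lambda / (1 - gamma * lambda).
have c4 : 4 < c by rewrite ltr_pdivlMr//; lra.
have reached k : (1 <= k)%N ->
    (forall j, (1 <= j < k)%N -> ~~ pds_stop gamma eta lambda x j) ->
    edom r (x k).
  case: k => [//|[//|k]] _ nstop.
  apply: (x_next k.+1 isT _).1 => j /andP[j1 jk].
  by apply: nstop; rewrite j1 (ltn_trans jk).
pose F k := fine (qs (x k)).
have decrease k : (1 <= k)%N ->
    (forall j, (1 <= j <= k)%N -> ~~ pds_stop gamma eta lambda x j) ->
    F k.+1 + c * eta <= F k.
  move=> k1 nstop.
  have nstop_lt j : (1 <= j < k)%N -> ~~ pds_stop gamma eta lambda x j.
    by move=> /andP[j1 jk]; apply: nstop; rewrite j1 ltnW.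
  have rk := reached k k1 nstop_lt.
  have [rk1 near_opt] := x_next k k1 nstop_lt.
  have wk : omegaX (x k) \is a fin_num.
    by rewrite fin_numE omegaX_Ny -ltey; exact: omegaX_edom.
  have breg : ((2^-1 * `|x k.+1 - x k| ^+ 2)%:E
      <= bregman omegaX (x k.+1) (x k))%E.
    apply: (bregman_ge omegaX_Ny omegaX_sc rk rk1); [exact: omegaX_edom..|].
    exact: (omegaX_C1 _ (omegaX_dom _ rk)).1.
  have := inexact_prox_descent lambda0 wk (qs_bnd _ rk).1 (qs_bnd _ rk1).1
    breg near_opt.
  have long : 2 * eta / (lambda^-1 - gamma) <= `|x k.+1 - x k| ^+ 2.
    have := nstop k; rewrite k1 leqnn => /(_ isT).
    rewrite /pds_stop -ltNge => /ltW step_ge.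
    have rad0 : 0 <= 2 * eta / (lambda^-1 - gamma).
      rewrite divr_ge0 ?mulr_ge0 ?(ltW eta_gt0)// subr_ge0 ltW//.
      by rewrite -[gamma]invrK ltf_pV2// posrE.
    by rewrite -(sqr_sqrtr rad0) lerXn2r ?nnegrE ?sqrtr_ge0.
  have := step_decrease lambda0 lambda_lt gamma_gt0 long.
  rewrite /F -/c -/qs; lra.
have lower k : (1 <= k)%N ->
    (forall j, (1 <= j < k)%N -> ~~ pds_stop gamma eta lambda x j) ->
    fine (qstar Phi g r Yc) - 2 * eta <= F k.
  move=> k1 nstop; have rk := reached k k1 nstop.
  have [_ /andP[lo _]] := qs_bnd _ rk.
  by apply: le_trans lo; rewrite lerD2r fine_le// qv_fin.
have ceta : 0 < c * eta by rewrite mulr_gt0// (lt_trans _ c4).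
have [K [runK KF]] := first_stop ceta decrease lower.
exists K; split=> //; have [K1 _ _] := runK.
have [_ /andP[_ F1]] := qs_bnd _ x1.
set Delta := fine _ - fine _.
have Delta0 : 0 <= Delta by rewrite subr_ge0 fine_le// qv_fin.
have ceta0 : 0 < (c - 4) * eta by rewrite mulr_gt0// subr_gt0.
suff : (K.-1%:Z <= Num.ceil (Delta / ((c - 4) * eta)))%R.
  by rewrite -lerBlDr; case: (K) K1 => // k _ /=;
    rewrite -[k.+1]addn1 PoszD addrK.
have [K_le1|K_ge2] := leqP K 1.
  have -> : K.-1 = 0%N by case: (K) K_le1 => [|[]].
  by rewrite ceil_ge0 (lt_le_trans (ltrN10 R))// divr_ge0// ltW.
rewrite -(ler_int R); apply: le_trans (ceil_ge _).
rewrite ler_pdivlMr//.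
have KFD : K.-1%:R * (c * eta) <= Delta + 4 * eta.
  by move: KF F1; rewrite /F /Delta /qv; lra.
(* [K >= 2] lets the telescoped steps absorb the smoothing error. *)
have K4 : 4 * eta <= K.-1%:R * (4 * eta).
  apply: ler_peMl; first by rewrite mulr_ge0// ltW.
  by rewrite ler1n; case: (K) K_ge2 => [|[]].
rewrite pmulrn mulrBl mulrBr; lra.
Qed.
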